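(* Let $\mathbf{P}, \mathbf{e}$ be idempotents in $\mathcal{U}$, let $\mathbf{R} = \mathbf{P} - \mathbf{e}$, and let $\Lambda = \mathbb{C} + \mathbb{C}\,\mathbf{e}$. Then, for any even number $q$, the chain $$\tau_q(\mathbf{R}) := \mathbf{R} \otimes_{\Lambda} \mathbf{R} \otimes_{\Lambda} \cdots \otimes_{\Lambda} \mathbf{R}\, \otimes_{\Lambda} \;\in\; C^{\Lambda}_{q}(\mathcal{U}) \qquad (q+1 \text{ factors } \mathbf{R})$$ is a local cyclic cycle of the algebra $\mathit{S}$ over the ring $\Lambda$; that is, $T(\tau_q(\mathbf{R})) = \tau_q(\mathbf{R})$ and $b'(\tau_q(\mathbf{R})) = 0$, all factors being operators with small support.
   Context: $M$ is a compact smooth manifold. $\mathit{S} = \mathbb{C}\cdot 1 + \mathcal{L}^{\infty}(M)$ is the unitarized algebra of smoothing operators on $M$ (matrices over it are also allowed, for operators on sections of vector bundles). The support of an operator is the support in $M\times M$ of its distributional kernel. $\mathcal{U}$ denotes the space of operators with small support about the diagonal of $M \times M$. It is assumed to be quasi-stable under products (products of operators with sufficiently small support again belong to it) and stable under products by elements of $\Lambda = \mathbb{C} + \mathbb{C}\,\mathbf{e}$. Chains over $\Lambda$: for an algebra $\mathit{A}$ (or a space $\mathit{A}$ of operators with small support about the diagonal of $M\times M$ that is quasi-stable under products, such as $\mathcal{U}$) that is a left and right $\Lambda$-module, $C^{\Lambda}_{k}(\mathit{A}) = C_{\Lambda,k}(\mathit{A}) := \otimes_{\Lambda}^{k+1}\mathit{A}$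 is the circular tensor product. This means that, in addition to the usual $\Lambda$-balancing between consecutive factors, one has $$f_0\otimes_\Lambda f_1\otimes_\Lambda\cdots\otimes_\Lambda (f_k f)\,\otimes_\Lambda = (f f_0)\otimes_\Lambda f_1\otimes_\Lambda\cdots\otimes_\Lambda f_k\,\otimes_\Lambda \quad\text{for } f\in\Lambda.$$ The trailing $\otimes_\Lambda$ indicates this circularity. The bar operator is $$b'(f_0\otimes_\Lambda\cdots\otimes_\Lambda f_k\otimes_\Lambda) = \sum_{r=0}^{k-1}(-1)^r f_0\otimes_\Lambda\cdots\otimes_\Lambda (f_r f_{r+1})\otimes_\Lambda\cdots\otimes_\Lambda f_k\otimes_\Lambda,$$ with $b'=0$ on $C_{\Lambda,0}$. The cyclic permutation is $$T(f_0\otimes_\Lambda\cdots\otimes_\Lambda f_k\otimes_\Lambda) = (-1)^k f_1\otimes_\Lambda f_2\otimes_\Lambda\cdots\otimes_\Lambda f_k\otimes_\Lambda f_0\otimes_\Lambda.$$ A chain $f$ is cyclic if $T(f)=f$. The cyclic homology over $\Lambda$ is the homology of the complex of cyclic chains with differential $b'$. A chain has support in $U\subset M\times M$ if every factor of each of its monomials has support in $U$. The local cyclic complex consists of the cyclic chains whose supports are contained in a sufficiently small neighbourhood $U$ of the diagonal, and a local cyclic cycle is a cycle of it. *)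

(* Defs.v *)
From HB Require Import structures.
From mathcomp Require Import all_boot all_order all_algebra.
From mathcomp Require Import all_classical all_reals all_analysis.
From mathcomp Require Import generic_quotient ring_quotient zify.
From mathcomp.real_closed Require Import complex.
From mathcomp.multinomials Require Import freeg.
Import GRing.Theory numFieldNormedType.Exports.

Set Implicit Arguments.
Unset Strict Implicit.
Unset Printing Implicit Defensive.

Local Open Scope classical_set_scope.
Local Open Scope ring_scope.
Local Open Scope quotient_scope.

Section LinearEndomorphisms.
Variables (K : comNzRingType) (V : lmodType K).

Definition endo := {linear V -> V}.

Implicit Types f g h : endo.

Lemma endoP f g : f =1 g -> f = g.
Proof.
case: f => f [[mf] [sf]]; case: g => g [[mg] [sg]] /= fg.
have E : f = g by apply/funext.
by subst g; rewrite (Prop_irrelevance mf mg) (Prop_irrelevance sf sg).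
Qed.

HB.instance Definition _ := gen_eqMixin endo.
HB.instance Definition _ := gen_choiceMixin endo.

Definition endo_zero : endo := \0.
Definition endo_opp f : endo := \- f.
Definition endo_add f g : endo := f \+ g.
Definition endo_one : endo := idfun.
Definition endo_mul f g : endo := f \o g.
Definition endo_scale (a : K) f : endo := a \*: f.

Fact endo_addA : associative endo_add.
Proof. by move=> f g h; apply: endoP => x; exact: addrA. Qed.
Fact endo_addC : commutative endo_add.
Proof. by move=> f g; apply: endoP => x; exact: addrC. Qed.
Fact endo_add0 : left_id endo_zero endo_add.
Proof. by move=> f; apply: endoP => x; exact: add0r. Qed.
Fact endo_addN : left_inverse endo_zero endo_opp endo_add.
Proof. by move=> f; apply: endoP => x; exact: addNr. Qed.
HB.instance Definition _ :=
  GRing.isZmodule.Build endo endo_addA endo_addC endo_add0 endo_addN.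

Fact endo_mulA : associative endo_mul.
Proof. by move=> f g h; apply: endoP. Qed.
Fact endo_mul1 : left_id endo_one endo_mul.
Proof. by move=> f; apply: endoP. Qed.
Fact endo_mulr1 : right_id endo_one endo_mul.
Proof. by move=> f; apply: endoP. Qed.
Fact endo_mulDl : left_distributive endo_mul +%R.
Proof. by move=> f g h; apply: endoP. Qed.
Fact endo_mulDr : right_distributive endo_mul +%R.
Proof. by move=> f g h; apply: endoP => x; exact: linearD. Qed.
HB.instance Definition _ := GRing.Zmodule_isPzRing.Build endo
  endo_mulA endo_mul1 endo_mulr1 endo_mulDl endo_mulDr.

Fact endo_scaleA a b f :
  endo_scale a (endo_scale b f) = endo_scale (a * b) f.
Proof. by apply: endoP => x; exact: scalerA. Qed.
Fact endo_scale1 : left_id 1 endo_scale.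
Proof. by move=> f; apply: endoP => x; exact: scale1r. Qed.
Fact endo_scaleDr : right_distributive endo_scale +%R.
Proof. by move=> a f g; apply: endoP => x; exact: scalerDr. Qed.
Fact endo_scaleDl f : {morph endo_scale^~ f : a b / a + b}.
Proof. by move=> a b; apply: endoP => x; exact: scalerDl. Qed.
HB.instance Definition _ := GRing.Zmodule_isLmodule.Build K endo
  endo_scaleA endo_scale1 endo_scaleDr endo_scaleDl.

End LinearEndomorphisms.

(* Circular tensor powers over the subring [L] of [A], of a subspace [X] of [A]
   that is stable under [L] but need not be closed under products.  As usual
   for tensor products over a ring, they are quotients of free abelian groups;
   the scalars of [L] give back the vector space structure. *)
Section CircularTensor.
Variables (A : pzRingType) (L X : set A).

Definition monomial k := {ffun 'I_k.+1 -> A}.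

Definition formal k := {freeg (monomial k)}.

Definition upd k (t : monomial k) (i : 'I_k.+1) (x : A) : monomial k :=
  [ffun j => if j == i then x else t j].

(* [ordS] is the cyclic successor: for the last index [i = k], [BalancingM] is
   the circular relation between the last and the first factor. *)
Inductive balancing k : formal k -> Prop :=
| Balancing0 : balancing 0
| BalancingB (z w : formal k) : balancing z -> balancing w -> balancing (z - w)
| BalancingD (t : monomial k) (i : 'I_k.+1) (x y : A) :
    (forall j, X (t j)) -> X x -> X y ->
    balancing (<< upd t i (x + y) >> - << upd t i x >> - << upd t i y >>)
| BalancingM (t : monomial k) (i : 'I_k.+1) (f : A) :
    (forall j, X (t j)) -> L f ->
    balancing (<< upd t i (t i * f) >>
               - << upd t (ordS i) (f * t (ordS i)) >>).

Definition balanced k (z : formal k) : bool := `[< balancing z >].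

Fact balanced_zmod_closed k : zmod_closed (@balanced k).
Proof.
split; first by apply/asboolP; exact: Balancing0.
by move=> z w /asboolP zb /asboolP wb; apply/asboolP; exact: BalancingB.
Qed.
HB.instance Definition _ k :=
  GRing.isZmodClosed.Build (formal k) (@balanced k) (balanced_zmod_closed k).

(* All relations in [balancing] only involve monomials with factors in [X], so
   the k-chains over [X] are the subgroup of the classes of those formal
   sums whose monomials have all their factors in [X]; see [factors_in]. *)
Definition ctensor k : zmodType :=
  Quotient.quot (GRing.ZmodClosed.clone (formal k) (@balanced k) _).

Definition chain_cls k (z : formal k) : ctensor k := \pi z.

Lemma chain_clsE k (z w : formal k) : chain_cls z = chain_cls w <-> balancing (z - w).
Proof.
split.
  by move=> /eqP; rewrite /chain_cls -Quotient.idealrBE => /asboolP.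
by move=> h; apply/eqP; rewrite /chain_cls -Quotient.idealrBE; apply/asboolP.
Qed.

Lemma chain_clsB k : {morph @chain_cls k : z w / z - w}.
Proof. by move=> z w; rewrite /chain_cls Quotient.pi_add Quotient.pi_opp. Qed.

Definition rot_factors k (t : monomial k) : monomial k := [ffun j => t (ordS j)].

Definition formal_cycT k : formal k -> formal k :=
  fglift (fun t => (-1) ^+ k *: << rot_factors t >>).

(* Independent of the representative by [cycT_chain_cls]. *)
Definition cycT k (x : ctensor k) : ctensor k :=
  chain_cls (formal_cycT (repr x)).

(* Replaces the factors of index r and r+1 by their product. *)
Definition mul_factors k (r : 'I_k) (t : monomial k) : monomial k.-1 :=
  [ffun j : 'I_k.-1.+1 =>
     if (j < r)%N then t (inord j)
     else if (j == r :> nat) then t (inord r) * t (inord r.+1)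
     else t (inord j.+1)].

Definition formal_bar k : formal k -> formal k.-1 :=
  fglift (fun t => \sum_(r < k) (-1) ^+ r *: << mul_factors r t >>).

Definition factors_in (Y : set A) k (z : formal k) :=
  forall t, t \in dom z -> forall i, Y (t i).

(* [bar_to x y] says that y is the image of x under the bar operator.  It is a
   relation because the bar operator on chains over [X] is only partially
   defined: the products of adjacent factors must again lie in [X].  If [X] is
   closed under products it is the graph of a total function, by [bar_to_inj]
   and [bar_to_ex].  In degree 0 the bar operator is 0, since the sum in
   [formal_bar] is then empty. *)
Definition bar_to k (x : ctensor k) (y : ctensor k.-1) :=
  exists z : formal k, [/\ factors_in X z,
    forall t, t \in dom z -> forall (r : 'I_k) i, X (mul_factors r t i),
    chain_cls z = x & chain_cls (formal_bar z) = y].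

(* [Y] is the set of operators with support in the given neighbourhood. *)
Definition local_cyclic_cycle (Y : set A) k (x : ctensor k) :=
  [/\ exists2 z : formal k, factors_in (X `&` Y) z & chain_cls z = x,
      cycT x = x & bar_to x 0].

Definition tau k (r : A) : ctensor k := chain_cls << [ffun=> r] : monomial k >>.

Lemma balancing_opp k (z : formal k) : balancing z -> balancing (- z).
Proof. by move=> zb; rewrite -sub0r; apply: BalancingB => //; exact: Balancing0. Qed.

Lemma balancing_add k (z w : formal k) :
  balancing z -> balancing w -> balancing (z + w).
Proof.
by move=> zb wb; rewrite -[w]opprK; apply: BalancingB => //; exact: balancing_opp.
Qed.

Lemma balancing_sign k n (z : formal k) :
  balancing z -> balancing ((-1) ^+ n *: z).
Proof.
move=> zb; rewrite -signr_odd; case: (odd n); rewrite ?expr0 ?scale1r //.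
by rewrite expr1 scaleN1r; exact: balancing_opp.
Qed.

Lemma formal_cycTB k : {morph @formal_cycT k : z w / z - w}.
Proof. exact: lift_is_additive. Qed.

Lemma formal_barB k : {morph @formal_bar k : z w / z - w}.
Proof. exact: lift_is_additive. Qed.

Lemma formal_cycTU k (t : monomial k) :
  formal_cycT << t >> = (-1) ^+ k *: << rot_factors t >>.
Proof. by rewrite /formal_cycT liftU scale1r. Qed.

Lemma formal_barU k (t : monomial k) :
  formal_bar << t >> = \sum_(r < k) (-1) ^+ r *: << mul_factors r t >>.
Proof. by rewrite /formal_bar liftU scale1r. Qed.

Lemma rot_factors_upd k (t : monomial k) i x :
  rot_factors (upd t (ordS i) x) = upd (rot_factors t) i x.
Proof.
by apply/ffunP => j; rewrite !ffunE (inj_eq (can_inj (@ordSK _))).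
Qed.

Lemma formal_cycT_balancing k (z : formal k) :
  balancing z -> balancing (formal_cycT z).
Proof.
elim=> {z} [|z w _ zb _ wb|t i x y Xt Xx Xy|t i f Xt Lf].
- by rewrite -(subrr 0) formal_cycTB subrr; exact: Balancing0.
- by rewrite formal_cycTB; exact: BalancingB.
- rewrite !formal_cycTB !formal_cycTU -!scalerBr -(ord_predK i) !rot_factors_upd.
  by apply: balancing_sign; apply: BalancingD => // j; rewrite ffunE.
- rewrite !formal_cycTB !formal_cycTU -!scalerBr.
  have -> : i = ordS (ord_pred i) by rewrite ord_predK.
  rewrite !rot_factors_upd; set j := ord_pred i.
  have -> : t (ordS j) = rot_factors t j by rewrite ffunE.
  have -> : t (ordS (ordS j)) = rot_factors t (ordS j) by rewrite ffunE.
  by apply: balancing_sign; apply: BalancingM => // l; rewrite ffunE.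
Qed.

Lemma cycT_chain_cls k (z : formal k) : cycT (chain_cls z) = chain_cls (formal_cycT z).
Proof.
apply/chain_clsE; rewrite -formal_cycTB; apply: formal_cycT_balancing.
by apply/chain_clsE; rewrite /chain_cls reprK.
Qed.

Section Closed.
Hypothesis XM : forall x y, X x -> X y -> X (x * y).

(* index of the factor of [mul_factors r t] to which the i-th factor of [t] goes *)
Let sq k (i : 'I_k.+2) (r : 'I_k.+1) : 'I_k.+1 :=
  inord (if (i <= r)%N then i : nat else i.-1).

Lemma mul_factors_upd k (t : monomial k.+1) (r : 'I_k.+1) i x :
  mul_factors r (upd t i x) = upd (mul_factors r t) (sq i r)
    (if i == r :> nat then x * t (inord r.+1)
     else if i == r.+1 :> nat then t (inord r) * x else x).
Proof.
have ir := ltn_ord r; have ii := ltn_ord i.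
apply/ffunP => j; have ij := ltn_ord j; rewrite !ffunE.
have e m (hm : (m < k.+2)%N) (l : 'I_k.+2) : ((inord m : 'I_k.+2) == l) = (m == l).
  by rewrite -val_eqE /= inordK.
have eq_sq : (j == sq i r) = (j == (if (i <= r)%N then i : nat else i.-1) :> nat).
  by rewrite -val_eqE /= inordK //; case: ifP => h; lia.
rewrite eq_sq !e; try lia.
have xi : (i = r.+1 :> nat) -> i = inord r.+1 by move=> h; apply/val_inj; rewrite /= inordK -?h.
have xr : (i = r :> nat) -> i = inord r by move=> h; apply/val_inj; rewrite /= inordK -?h.
case: (ltngtP i r) => ir'; case: (ltngtP j r) => jr;
 case: (eqVneq (i : nat) r.+1) => ir1; try lia;
 repeat (case: eqP => ?); try lia; try done.
all: try by rewrite ?(xi ir1) ?(xr ir').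
Qed.

Lemma sq_ordS k (i : 'I_k.+2) (r : 'I_k.+1) : i != r :> nat ->
  sq (ordS i) r = ordS (sq i r).
Proof.
have ir := ltn_ord r; have ii := ltn_ord i => nir.
apply/val_inj; rewrite /= /sq /=.
rewrite [X in _ = (X.+1 %% _)%N]inordK; last by case: ifP; lia.
have [iE|iN] := eqVneq (i : nat) k.+1.
  rewrite iE modnn inordK //=; case: ifP => h; first lia.
  by rewrite modnn.
rewrite modn_small; last lia.
rewrite inordK; last by case: ifP; lia.
rewrite modn_small; repeat case: ifP => ?; lia.
Qed.

Lemma mul_factors_sq k (t : monomial k.+1) (r : 'I_k.+1) i :
  mul_factors r t (sq i r) =
    (if i == r :> nat then t i * t (inord r.+1)
     else if i == r.+1 :> nat then t (inord r) * t i else t i).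
Proof.
have {1}-> : t = upd t i (t i) by apply/ffunP => j; rewrite ffunE; case: eqP => // ->.
by rewrite mul_factors_upd ffunE eqxx.
Qed.

Lemma mul_factors_in k (t : monomial k.+1) (r : 'I_k.+1) :
  (forall j, X (t j)) -> forall j, X (mul_factors r t j).
Proof. by move=> Xt j; rewrite ffunE; do 2?case: ifP => // _; exact: XM. Qed.

Lemma formal_bar_balancing k (z : formal k) :
  balancing z -> balancing (formal_bar z).
Proof.
elim=> {z} [|z w _ zb _ wb|t i x y Xt Xx Xy|t i f Xt Lf].
- by rewrite -(subrr 0) formal_barB subrr; exact: Balancing0.
- by rewrite formal_barB; exact: BalancingB.
- rewrite !formal_barB !formal_barU -!sumrB.
  elim/big_ind: _ => [|? ? ? ?|r _]; first exact: Balancing0.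
    exact: balancing_add.
  rewrite -!scalerBr; apply: balancing_sign.
  case: k t i r Xt => [|k] t i r Xt; first by case: r.
  rewrite !mul_factors_upd.
  case: ifP => _; last case: ifP => _.
  - by rewrite mulrDl; apply: BalancingD => [j||]; [exact: mul_factors_in|exact: XM|exact: XM].
  - by rewrite mulrDr; apply: BalancingD => [j||]; [exact: mul_factors_in|exact: XM|exact: XM].
  - by apply: BalancingD => // j; exact: mul_factors_in.
- rewrite !formal_barB !formal_barU -!sumrB.
  elim/big_ind: _ => [|? ? ? ?|r _]; first exact: Balancing0.
    exact: balancing_add.
  rewrite -!scalerBr; apply: balancing_sign.
  case: k t i r Xt => [|k] t i r Xt; first by case: r.
  have ir := ltn_ord r; have ii := ltn_ord i; rewrite !mul_factors_upd.
  have [iE|iN] := eqVneq (i : nat) r.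
    have SiE : ordS i = r.+1 :> nat by rewrite /= iE modn_small.
    rewrite SiE (gtn_eqF (ltnSn r)) eqxx.
    have -> : sq (ordS i) r = sq i r.
      by congr (inord _); rewrite SiE ltnn iE leqnn.
    have -> : inord r = i by apply/val_inj; rewrite /= inordK //; lia.
    have -> : inord r.+1 = ordS i by apply/ord_inj; rewrite SiE inordK.
    by rewrite !mulrA subrr; exact: Balancing0.
  rewrite (sq_ordS iN).
  have -> : (if i == r.+1 :> nat then t (inord r) * (t i * f) else t i * f) =
            mul_factors r t (sq i r) * f.
    by rewrite mul_factors_sq (negbTE iN); case: ifP; rewrite ?mulrA.
  have SiN : (ordS i == r.+1 :> nat) = false.
    apply/negbTE/eqP => /=; have [->|?] := eqVneq (i : nat) k.+1.
      by rewrite modnn.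
    by rewrite modn_small; lia.
  have -> : (if ordS i == r :> nat then f * t (ordS i) * t (inord r.+1)
     else if ordS i == r.+1 :> nat then t (inord r) * (f * t (ordS i))
     else f * t (ordS i)) = f * mul_factors r t (ordS (sq i r)).
    by rewrite -(sq_ordS iN) mul_factors_sq SiN; case: ifP; rewrite ?mulrA.
  by apply: BalancingM => // j; exact: mul_factors_in.
Qed.

Lemma bar_to_inj k (x : ctensor k) y1 y2 :
  bar_to x y1 -> bar_to x y2 -> y1 = y2.
Proof.
move=> [z [_ _ zx <-]] [w [_ _ wx <-]]; apply/chain_clsE; rewrite -formal_barB.
by apply: formal_bar_balancing; apply/chain_clsE; rewrite zx.
Qed.

Lemma bar_to_ex k (z : formal k) :
  factors_in X z -> exists y, bar_to (chain_cls z) y.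
Proof.
move=> Xz; exists (chain_cls (formal_bar z)), z; split => // t tz.
by case: k z Xz t tz => [|k] z Xz t tz r; [case: r|apply: mul_factors_in; exact: Xz].
Qed.

End Closed.

End CircularTensor.

(* [smooth_on O f]: on the open set O, all iterated directional derivatives of
   f exist and are continuous. *)
Section Smoothness.
Variables (R : realType).

Fixpoint ck_on (V W : normedModType R) (k : nat) (O : set V) (f : V -> W) : Prop :=
  (forall x, O x -> {for x, continuous f}) /\
  match k with
  | 0 => True
  | k'.+1 => forall v, (forall x, O x -> derivable f x v) /\ ck_on k' O ('D_v f)
  end.

Definition smooth_on (V W : normedModType R) (O : set V) (f : V -> W) :=
  forall k, ck_on k O f.

Definition csmooth_on (V : normedModType R) (O : set V) (f : V -> R[i]) :=
  smooth_on O (fun x => complex.Re (f x)) /\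
  smooth_on O (fun x => complex.Im (f x)).

Section Closure.
Variables (V W : normedModType R) (O : set V).
Hypothesis oO : open O.
Implicit Types f g : V -> W.

Lemma eq_ck_on k f g : (forall x, O x -> f x = g x) -> ck_on k O f -> ck_on k O g.
Proof.
have near_fg f1 g1 : (forall x, O x -> f1 x = g1 x) ->
    forall x, O x -> \near x, f1 x = g1 x.
  move=> fg x Ox; have := open_nbhs_nbhs (conj oO Ox).
  by apply: filterS => y; exact: fg.
have cont f1 g1 : (forall x, O x -> f1 x = g1 x) ->
    (forall x, O x -> {for x, continuous f1}) ->
    forall x, O x -> {for x, continuous g1}.
  move=> fg fc x Ox; have fcx : f1 @ x --> f1 x := fc x Ox.
  suff : g1 @ x --> g1 x by [].
  rewrite -fg//; apply: cvg_trans fcx; apply: near_eq_cvg.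
  exact: near_fg.
elim: k f g => [|k IHk] f g fg /= [fc fd].
  by split => //; exact: cont fc.
split; first exact: cont fc.
move=> v; have [fdv fk] := fd v; split.
  by move=> x Ox; apply: near_eq_derivable (fdv _ Ox); exact: near_fg.
by apply: IHk fk => x Ox; apply: near_eq_derive; exact: near_fg.
Qed.

Lemma ck_onD k f g : ck_on k O f -> ck_on k O g -> ck_on k O (f + g).
Proof.
elim: k f g => [|k IHk] f g /= [fc fd] [gc gd]; split => //.
- by move=> x Ox; apply: continuousD; [exact: fc|exact: gc].
- by move=> x Ox; apply: continuousD; [exact: fc|exact: gc].
move=> v; have [fdv fk] := fd v; have [gdv gk] := gd v; split.
  by move=> x Ox; apply: derivableD; [exact: fdv|exact: gdv].
apply: eq_ck_on (IHk _ _ fk gk) => x Ox.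
by rewrite deriveD //; [exact: fdv|exact: gdv].
Qed.

Lemma ck_onZ k (a : R) f : ck_on k O f -> ck_on k O (a \*: f).
Proof.
elim: k f => [|k IHk] f /= [fc fd]; split => //.
- by move=> x Ox; apply: continuousZl_tmp; exact: fc.
- by move=> x Ox; apply: continuousZl_tmp; exact: fc.
move=> v; have [fdv fk] := fd v; split.
  by move=> x Ox; apply: derivableZ; exact: fdv.
apply: eq_ck_on (IHk _ fk) => x Ox.
by rewrite deriveZ //; exact: fdv.
Qed.

Lemma ck_on0 k : ck_on k O (0 : V -> W).
Proof.
elim: k => [|k IHk] /=; (split; first by move=> x _; exact: cvg_cst) => //.
move=> v; split; first by move=> x _; exact: derivable_cst.
by apply: eq_ck_on IHk => x _; rewrite derive_cst.
Qed.

End Closure.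

Lemma csmooth_on_submod (V : normedModType R) (O : set V) : open O ->
  [/\ csmooth_on O (fun=> 0),
      forall f g, csmooth_on O f -> csmooth_on O g ->
        csmooth_on O (fun x => f x + g x) &
      forall (a : R[i]) f, csmooth_on O f -> csmooth_on O (fun x => a * f x)].
Proof.
move=> oO; split.
- by split=> k; exact: ck_on0.
- move=> f g [fr fi] [gr gi]; split=> k.
  + apply: eq_ck_on (ck_onD oO (fr k) (gr k)) => // x _ /=.
    by rewrite !fctE; case: (f x) => ? ?; case: (g x) => ? ?.
  + apply: eq_ck_on (ck_onD oO (fi k) (gi k)) => // x _ /=.
    by rewrite !fctE; case: (f x) => ? ?; case: (g x) => ? ?.
- move=> [a b] f [fr fi]; split=> k.
  + apply: eq_ck_on (ck_onD oO (ck_onZ oO a (fr k)) (ck_onZ oO (- b) (fi k))) => // x _ /=.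
    by rewrite !fctE /= scaleNr; case: (f x).
  + apply: eq_ck_on (ck_onD oO (ck_onZ oO a (fi k)) (ck_onZ oO b (fr k))) => // x _ /=.
    by rewrite !fctE /=; case: (f x).
Qed.

End Smoothness.

(* Only the values of [cmap] on [cdom] and of [cinv] on [cmap @` cdom] matter. *)
Record chart (R : realType) (d : nat) (M : topologicalType) := Chart {
  cdom : set M;
  cmap : M -> 'rV[R]_d;
  cinv : 'rV[R]_d -> M;
  cdom_open : open cdom;
  cimg_open : open (cmap @` cdom);
  cmapK : forall x, cdom x -> cinv (cmap x) = x;
  cmap_continuous : forall x, cdom x -> {for x, continuous cmap};
  cinv_continuous :
    forall y, (cmap @` cdom) y -> {for y, continuous cinv}
}.

Definition cimg R d M (c : chart R d M) : set 'rV[R]_d := cmap c @` cdom c.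

Record compact_manifold (R : realType) (d : nat) := CompactManifold {
  mspace :> topologicalType;
  atlas : set (chart R d mspace);
  atlas_cover : forall x, exists2 c, atlas c & cdom c x;
  atlas_compatible : forall c1 c2, atlas c1 -> atlas c2 ->
    smooth_on (cimg c1 `&` cinv c1 @^-1` cdom c2) (cmap c2 \o cinv c1);
  mspace_hausdorff : hausdorff_space mspace;
  mspace_compact : compact [set: mspace]
}.

Section SmoothingOperators.
Variables (R : realType) (d : nat) (M : compact_manifold R d).
Local Notation C := R[i].

Definition smooth_pred (f : M -> C^o) : bool :=
  `[< forall c, atlas c -> csmooth_on (cimg c) (f \o cinv c) >].

Fact smooth_submod_closed : submod_closed smooth_pred.
Proof.
split.
  apply/asboolP => c _.
  by have [h _ _] := csmooth_on_submod (@cimg_open _ _ _ c).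
move=> a f g /asboolP fs /asboolP gs; apply/asboolP => c ca.
have [_ hD hM] := csmooth_on_submod (@cimg_open _ _ _ c).
exact: hD (hM a _ (fs c ca)) (gs c ca).
Qed.
HB.instance Definition _ :=
  GRing.isSubmodClosed.Build C (M -> C^o) smooth_pred smooth_submod_closed.

Record smooth_fun := SmoothFun {
  smooth_val :> M -> C^o;
  smooth_valP : smooth_val \in smooth_pred }.

HB.instance Definition _ := [isSub for smooth_val].
HB.instance Definition _ := [Choice of smooth_fun by <:].
HB.instance Definition _ := [SubChoice_isSubLmodule of smooth_fun by <:].

Definition operator := endo smooth_fun.

Definition fsupp (f : M -> C) : set M := closure [set x | f x != 0].

(* Lebesgue integral over R^n as an iterated integral; it is only applied to
   continuous functions with compact support. *)
Fixpoint riint n : ('rV[R]_n -> R) -> R :=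
  match n with
  | 0 => fun g => g 0
  | n'.+1 => fun g => \int[lebesgue_measure]_(t in setT)
      riint (fun y : 'rV[R]_n' => g (row_mx (const_mx t : 'rV[R]_1) y))
  end.

Definition ciint (D : set 'rV[R]_d) (g : 'rV[R]_d -> C) : C :=
  let h := patch (fun=> 0) D g in
  Complex (riint (fun y => complex.Re (h y))) (riint (fun y => complex.Im (h y))).

Definition smooth_kernel (c : chart R d M) (k : M -> 'rV[R]_d -> C) :=
  forall c', atlas c' ->
    csmooth_on (cimg c' `*` cimg c) (fun p => k (cinv c' p.1) p.2).

(* The Schwartz kernel of a is smooth.  The kernel is a density in its second
   variable; k is its coefficient with respect to the coordinates of c. *)
Definition smoothing (a : operator) :=
  forall c : chart R d M, atlas c ->
  exists2 k, smooth_kernel c k &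
    forall f : smooth_fun, fsupp f `<=` cdom c ->
    forall x, a f x = ciint (cimg c) (fun y => k x y * f (cinv c y)).

Definition unitarized : set operator :=
  [set a : operator | exists (l : C) (s : operator),
     smoothing s /\ a = l *: (1 : operator) + s].

(* The Schwartz kernel of a vanishes on V x W, i.e. on the test functions
   phi dy (x) psi, with phi dy a smooth density supported in V (in coordinates)
   and psi a smooth function supported in W; these span a dense subspace. *)
Definition kernel_vanishes (a : operator) (V W : set M) :=
  forall (c : chart R d M) (phi psi : smooth_fun), atlas c ->
    fsupp phi `<=` V `&` cdom c -> fsupp psi `<=` W ->
    ciint (cimg c) (fun y => phi (cinv c y) * a psi (cinv c y)) = 0.

Definition osupp (a : operator) : set (M * M) :=
  ~` [set p | exists V W, [/\ open V, open W, V p.1, W p.2 & kernel_vanishes a V W]].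

Variable N : nat.

Definition msupp (a : 'M[operator]_N) : set (M * M) :=
  \bigcup_(ij in [set: 'I_N * 'I_N]) osupp (a ij.1 ij.2).

Definition munitarized : set 'M[operator]_N :=
  [set a | forall i j, unitarized (a i j)].

Definition supported_in (U : set (M * M)) : set 'M[operator]_N :=
  [set a | msupp a `<=` U].

Definition diag_nbhd (U : set (M * M)) := forall x : M, nbhs (x, x) U.

Definition cscal (l : C) : 'M[operator]_N := (l *: (1 : operator))%:M.

Definition Lambda (e : 'M[operator]_N) : set 'M[operator]_N :=
  [set f | exists l m : C, f = cscal l + cscal m * e].

(* A space of operators with small support about the diagonal: its elements
   have support in the given U, it contains every operator whose support is
   close enough to the diagonal, and it is quasi-stable under products.  It is
   not required to be the space of all operators with support in U: that space
   is in general not stable under multiplication by an idempotent e. *)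
Record small_support_space (U : set (M * M)) (B : set 'M[operator]_N) := {
  sss0 : B 0;
  sssD : forall a b, B a -> B b -> B (a + b);
  sssZ : forall l a, B a -> B (cscal l * a);
  sss_S : B `<=` munitarized `&` supported_in U;
  sss_small : exists2 V, diag_nbhd V & munitarized `&` supported_in V `<=` B;
  sss_quasi_stable : exists2 V, diag_nbhd V &
    forall a b, B a -> B b -> msupp a `<=` V -> msupp b `<=` V -> B (a * b)
}.

Definition stable_under (L B : set 'M[operator]_N) :=
  forall f a, L f -> B a -> B (f * a) /\ B (a * f).

End SmoothingOperators.

(* Main.v *)
From HB Require Import structures.
Require Import Defs.
From mathcomp Require Import all_boot all_order all_algebra.
From mathcomp Require Import all_classical all_reals all_analysis.
From mathcomp.real_closed Require Import complex.
From mathcomp.multinomials Require Import freeg.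
Import GRing.Theory.

(** The cyclic symmetry is immediate: rotating equal factors only produces the
    sign [(-1) ^+ q], which is [1] for even [q].

    For the bar operator, write [r = P - e] and expand [P = P * P] with
    [P = r + e]. Since [e * e = e] this gives [r = r * r + e * r + r * e]
    ([sub_idempotent_sqr]), so that the chain with [r * r] in position [s] and
    [r] elsewhere is, by multilinearity, [w] minus the two chains with [e * r],
    resp. [r * e], in position [s], where [w] has all its [q] factors equal to
    [r]. Let [E s] be the chain with [e * r] in position [s]. As [e] belongs
    to the ground ring, it moves to the next factor, and the chain with
    [r * e] in position [s] is [E s.+1]. Hence the bar operator yields
    [\sum_(s < q) (-1) ^+ s (w - E s - E s.+1)]. For even [q] the [w]'s cancel
    in pairs and the rest telescopes to [E q - E 0]
    ([alternating_telescope]), which vanishes because the tensor product is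
    circular: positions [q] and [0] are the same.

    All chains above have factors [r], [e * r], [r * e], [r * r], or
    [e * r + r * e]. These lie in [B] by stability under [e]; in particular
    [r * r = r - (e * r + r * e)] does, although [B] is only quasi-stable under
    products. *)

Set Implicit Arguments.
Unset Strict Implicit.
Unset Printing Implicit Defensive.

Local Open Scope classical_set_scope.
Local Open Scope ring_scope.

Section CircularTensorRelations.
Variables (A : pzRingType) (L X : set A).

HB.instance Definition _ k :=
  GRing.isZmodMorphism.Build (formal A k) (ctensor L X k) (@chain_cls A L X k)
    (@chain_clsB A L X k).

(** The signs of formal chains are scalars over the integers as a ring, while
    the quotient is only an abelian group; hence the change of action. *)
Lemma chain_clsZsign k (z : formal A k) n :
  chain_cls L X ((-1) ^+ n *: z) = chain_cls L X z *~ (-1) ^+ n.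
Proof.
rewrite -signr_odd; case: (odd n); last by rewrite !expr0 scale1r.
by rewrite !expr1 scaleN1r raddfN mulrN1z.
Qed.

Lemma chain_cls_updD k (t : monomial A k) i x y :
    (forall j, X (t j)) -> X x -> X y ->
  chain_cls L X << upd t i (x + y) >> =
    chain_cls L X << upd t i x >> + chain_cls L X << upd t i y >>.
Proof.
by move=> Xt Xx Xy; rewrite -raddfD; apply/chain_clsE; rewrite opprD addrA;
  apply: BalancingD.
Qed.

Lemma chain_cls_updM k (t : monomial A k) i f : (forall j, X (t j)) -> L f ->
  chain_cls L X << upd t i (t i * f) >> =
    chain_cls L X << upd t (ordS i) (f * t (ordS i)) >>.
Proof. by move=> Xt Lf; apply/chain_clsE; apply: BalancingM. Qed.

Lemma cycT_tau k r : ~~ odd k -> cycT (tau L X k r) = tau L X k r.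
Proof.
move=> ek; rewrite /tau cycT_chain_cls formal_cycTU -signr_odd (negbTE ek).
by rewrite expr0 scale1r; congr (chain_cls _ _ << _ >>); apply/ffunP => j; rewrite !ffunE.
Qed.

End CircularTensorRelations.

Lemma mul_factors_const (A : pzRingType) n (s : 'I_n.+1) (r : A) :
  mul_factors s ([ffun=> r] : monomial A n.+1) =
    upd ([ffun=> r] : monomial A n) s (r * r).
Proof.
by apply/ffunP => j; rewrite !ffunE -val_eqE; case: (ltngtP j s).
Qed.

(** The summand is the increment at [s] of the sequence that is [E s] for even
    [s] and [a - E s] for odd [s]. *)
Lemma alternating_telescope (V : zmodType) (a : V) (E : nat -> V) n :
  \sum_(0 <= s < n) (a - (E s + E s.+1)) *~ (-1) ^+ s =
    (if odd n then a - E n else E n) - E 0.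
Proof.
have -> : (if odd n then a - E n else E n) - E 0%N =
    \sum_(0 <= s < n) ((if odd s.+1 then a - E s.+1 else E s.+1) -
                       (if odd s then a - E s else E s)).
  by rewrite (telescope_sumr (fun s => if odd s then a - E s else E s)).
apply: eq_bigr => s _; rewrite -signr_odd /=; case: (odd s) => /=.
  by rewrite expr1 mulrN1z !opprB [E s + _]addrC addrA.
by rewrite expr0 mulr1z opprD addrA addrAC.
Qed.

(** [X] is asked to contain exactly the factors that occur in the computation,
    so that it can be a space of operators with small support, where products
    of arbitrary elements may leave the space. *)
Section BarOfTau.
Variables (A : pzRingType) (L X : set A) (e r : A).
Hypotheses (Le : L e) (Xr : X r) (Xer : X (e * r)) (Xre : X (r * e)).
Hypotheses (Xs : X (e * r + r * e)) (Xrr : X (r * r)).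
Hypothesis rE : r = r * r + (e * r + r * e).

Lemma chain_cls_bar_tau n : ~~ odd n ->
  chain_cls L X (formal_bar << [ffun=> r] : monomial A n >>) = 0.
Proof.
case: n => [|n] en; first by rewrite formal_barU big_ord0 raddf0.
rewrite formal_barU raddf_sum.
pose w : monomial A n := [ffun=> r].
(* Reducing [s] modulo the number of factors builds in [E n.+1 = E 0]. *)
pose E s := chain_cls L X << upd w (inord (s %% n.+1)) (e * r) >>.
have Xw j : X (w j) by rewrite ffunE.
have barE (s : 'I_n.+1) :
    chain_cls L X << mul_factors s ([ffun=> r] : monomial A n.+1) >> =
    chain_cls L X << w >> - (E s + E s.+1).
  have wE : w = upd w s (r * r + (e * r + r * e)).
    by rewrite -rE; apply/ffunP => j; rewrite !ffunE; case: ifP.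
  rewrite mul_factors_const [in RHS]wE !chain_cls_updD //.
  have -> : E s = chain_cls L X << upd w s (e * r) >>.
    by rewrite /E modn_small // inord_val.
  (* [e] crosses to the next factor; for [s = n] this is the circular
     relation. *)
  have -> : E s.+1 = chain_cls L X << upd w s (r * e) >>.
    have := chain_cls_updM s Xw Le; rewrite !ffunE => ->.
    by rewrite /E; congr (chain_cls _ _ << upd _ _ _ >>); apply/val_inj;
      rewrite /= inordK // ltn_mod.
  by rewrite addrK.
transitivity (\sum_(0 <= s < n.+1)
    (chain_cls L X << w >> - (E s + E s.+1)) *~ (-1) ^+ s).
  by rewrite big_mkord; apply: eq_bigr => s _ /=; rewrite -barE -chain_clsZsign.
by rewrite alternating_telescope (negbTE en) /E modnn mod0n subrr.
Qed.

Lemma tau_local_cyclic_cycle (Y : set A) n : Y r -> ~~ odd n ->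
  local_cyclic_cycle Y (tau L X n r).
Proof.
move=> Yr en; split; last 1 first.
- exists << [ffun=> r] >>; split => //.
  + by move=> t; rewrite domU1 inE => /eqP -> i; rewrite ffunE.
  + move=> t; rewrite domU1 inE => /eqP -> {t}.
    case: n en => [|n] en s i; first by case: s.
    by rewrite mul_factors_const !ffunE; case: ifP.
  + exact: chain_cls_bar_tau.
- exists << [ffun=> r] >> => //.
  by move=> t; rewrite domU1 inE => /eqP -> i; rewrite ffunE.
- exact: cycT_tau.
Qed.

End BarOfTau.

(** With [r := p - e], this is [p * p = p] expanded for [p = r + e], with
    [e * e = e] cancelled. *)
Lemma sub_idempotent_sqr (A : pzRingType) (p e : A) :
  p * p = p -> e * e = e ->
  p - e = (p - e) * (p - e) + (e * (p - e) + (p - e) * e).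
Proof.
move=> pp ee; have pE : p = (p - e) + e by rewrite subrK.
move: (p - e) pE => r pE; apply: (addIr e); rewrite -[LHS]pE -pp pE mulrDl !mulrDr ee.
by rewrite [e * r + r * e]addrC !addrA.
Qed.

Theorem theorem21 (R : realType) (d : nat) (M : compact_manifold R d) (N : nat)
  (U : set (M * M)) (hU : diag_nbhd U)
  (B : set 'M[operator M]_N) (hB : small_support_space U B)
  (P e : 'M[operator M]_N) (hP : B P) (he : B e)
  (idemP : P * P = P) (ideme : e * e = e)
  (hL : stable_under (Lambda e) B)
  (q : nat) (hq : ~~ odd q) :
  local_cyclic_cycle (supported_in U) (tau (Lambda e) B q (P - e)) /\
  local_cyclic_cycle (supported_in U)
    (tau (Lambda e) (@munitarized R d M N) q (P - e)).
Proof.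
have BN a : B a -> B (- a).
  by move=> Ba; have := sssZ hB (-1) Ba; rewrite /cscal scaleN1r raddfN mulN1r.
have Le : Lambda e e.
  by exists 0, 1; rewrite /cscal scale0r raddf0 add0r scale1r mul1r.
have BR : B (P - e) by apply: (sssD hB) => //; exact: BN.
have [BeR BRe] := hL _ _ Le BR.
have Bs := sssD hB BeR BRe.
have RE := sub_idempotent_sqr idemP ideme.
(* [B] need not be closed under products, so [r * r] is reached through sums
   and multiplication by [e]. *)
have BRR : B ((P - e) * (P - e)).
  have -> : (P - e) * (P - e) = (P - e) - (e * (P - e) + (P - e) * e).
    by apply/eqP; rewrite eq_sym subr_eq -RE.
  by apply: (sssD hB) => //; exact: BN.
have BS a : B a -> munitarized a by move=> /(sss_S hB) [].
have UR : supported_in U (P - e) by have [] := sss_S hB BR.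
by split; apply: (tau_local_cyclic_cycle (e := e)); auto.
Qed.
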